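(* For every $\alpha,d\in(0,1]$ there exist an integer $n_0$ and a real $\rho>0$ such that the following holds for all $n\ge n_0$. Let $H$ be an $n$-vertex $(\rho,d)$-cherry-dense $3$-graph satisfying $\delta_1(H)\ge \alpha\binom{n}{2}$. Then $H$ contains a tight Hamilton cycle.
   Context: A $3$-graph $H$ has vertex set $V(H)$ and edge set $E(H)$ consisting of $3$-element subsets of $V(H)$. For a vertex $v$, $\deg_H(v)$ is the number of edges containing $v$, and $\delta_1(H)=\min_{v\in V(H)}\deg_H(v)$. For sets $\vec G_1,\vec G_2\subseteq V(H)\times V(H)$ of ordered pairs, let $\mathcal P_2(\vec G_1,\vec G_2)=\{(x,y,z)\in V(H)^3:(x,y)\in\vec G_1,(y,z)\in\vec G_2\}$ and $e_H(\vec G_1,\vec G_2)=|\{(x,y,z)\in\mathcal P_2(\vec G_1,\vec G_2):\{x,y,z\}\in E(H)\}|$. An $n$-vertex $3$-graph $H$ is $(\rho,d)$-cherry-dense if $e_H(\vec G_1,\vec G_2)\ge d|\mathcal P_2(\vec G_1,\vec G_2)|-\rho n^3$ for all $\vec G_1,\vec G_2\subseteq V(H)\times V(H)$. A tight cycle is a $3$-graph whose vertices can be cyclically ordered so that every three consecutive vertices form an edge; a tight Hamilton cycle of $H$ is a tight cycle in $H$ containing all vertices of $H$. *)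

(* Defs.v *)
From HB Require Import structures.
From mathcomp Require Import all_boot all_order all_algebra all_fingroup.
From mathcomp Require Export reals.
Set Implicit Arguments. Unset Strict Implicit. Unset Printing Implicit Defensive.
Import Order.TTheory GRing.Theory Num.Theory.
Local Open Scope ring_scope.

Record hyp3 (n : nat) := Hyp3 {
  hedges : {set {set 'I_n}};
  hedges_card3 : forall e, e \in hedges -> #|e| = 3 }.

Definition hdeg n (H : hyp3 n) (v : 'I_n) : nat :=
  #|[set e in hedges H | v \in e]|.

(* minimum vertex degree delta_1(H) (for n = 0 the minimum over the empty set is taken to be 0) *)
Definition min_deg n (H : hyp3 n) : nat :=
  \big[minn/(if n is 0 then 0 else #|hedges H|)]_(v : 'I_n) hdeg H v.

Definition cherries n (G1 G2 : {set 'I_n * 'I_n}) : {set 'I_n * 'I_n * 'I_n} :=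
  [set t | ((t.1.1, t.1.2) \in G1) && ((t.1.2, t.2) \in G2)].

Definition e_H n (H : hyp3 n) (G1 G2 : {set 'I_n * 'I_n}) : nat :=
  #|[set t in cherries G1 G2 | [set t.1.1; t.1.2; t.2] \in hedges H]|.

Definition cherry_dense (R : realType) n (H : hyp3 n) (rho d : R) : Prop :=
  forall G1 G2 : {set 'I_n * 'I_n},
    d * (#|cherries G1 G2|)%:R - rho * (n%:R ^+ 3) <= (e_H H G1 G2)%:R.

Definition has_tight_ham_cycle n (H : hyp3 n) : Prop :=
  exists sigma : {perm 'I_n},
    forall i : 'I_n,
      [set sigma i; sigma (ordS i); sigma (ordS (ordS i))] \in hedges H.

(* Main.v *)
Require Import Defs.
From HB Require Import structures.
From mathcomp Require Import all_boot all_order all_algebra all_fingroup.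
From mathcomp Require Import reals zify ring lra.
Set Implicit Arguments. Unset Strict Implicit. Unset Printing Implicit Defensive.
Import Order.TTheory GRing.Theory Num.Theory.
Local Open Scope ring_scope.

(** Absorption, without random choices. The cherry condition is bilinear, hence holds
    for weights in [0,1]; applying it twice shows that for relations F, M, B the tight
    paths x y z w with F(x,y), M(y,z), B(z,w) number at least
    d^2 #{(x,y,z,w) : F(x,y), M(y,z), B(z,w)} - 2 rho n^4.
    Call (a,b) good for a set U if there are at least 2 beta n^2 pairs (z,w) in U such
    that a b z w is a tight path. The estimate has three consequences: as long as
    U has linear size almost all pairs are good for U; any two good pairs are joined by a
    tight path with four inner vertices in U; and, since every link is dense, every v has
    a positive proportion of absorbers, i.e. tight paths x1 x2 x3 x4 such that
    x1 x2 v x3 x4 is also a tight path.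

    A tight path both of whose end pairs are good for the set U of unvisited vertices can
    be prolonged at both ends by pairs that are good again. A first stage inserts
    absorbers, each chosen to absorb a positive proportion of sum_v 2^-(absorbers of v),
    until every vertex has k of them, with k linear in n. Then both ends are prolonged
    greedily until at most k vertices are unvisited; the ends are joined inside U and the
    leftover vertices are absorbed. *)

(** * Weighted cherry density *)

Lemma exchange_sum3 (R : nmodType) (I J K : finType) (F : I -> J -> K -> R) :
  \sum_i \sum_j \sum_k F i j k = \sum_j \sum_k \sum_i F i j k.
Proof.
by rewrite exchange_big; apply: eq_bigr => j _; rewrite exchange_big.
Qed.

Lemma card_rel_sum (R : pzSemiRingType) (T : finType) (P : rel T) :
  #|[set p : T * T | P p.1 p.2]|%:R = \sum_x \sum_y (P x y)%:R :> R.
Proof.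
rewrite pair_big /= -sum1_card natr_sum big_mkcond /=.
by apply: eq_bigr => -[x y] _; rewrite inE /=; case: (P x y).
Qed.

Section Density.

Variables (R : realType) (T : finType) (E : T -> T -> T -> bool) (d rho : R).
Hypotheses (d_ge0 : 0 <= d) (d_le1 : d <= 1) (rho_ge0 : 0 <= rho).
Local Notation N := (#|T|%:R : R).
Local Notation Er x y z := ((E x y z)%:R : R).
Hypothesis E_dense : forall f g : rel T,
  d * (\sum_x \sum_y \sum_z (f x y && g y z)%:R) - rho * N ^+ 3
    <= \sum_x \sum_y \sum_z ([&& f x y, g y z & E x y z])%:R.

Let phi (f g : T -> T -> R) :=
  \sum_x \sum_y \sum_z f x y * g y z * (Er x y z - d).

Let phi_rel (f g : rel T) :
  - (rho * N ^+ 3) <= phi (fun x y => (f x y)%:R) (fun x y => (g x y)%:R).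
Proof.
have := E_dense f g; rewrite /phi => h.
set S1 := \sum_x _ in h; set S2 := \sum_x _ in h.
suff -> : \sum_x \sum_y \sum_z (f x y)%:R * (g y z)%:R * (Er x y z - d)
   = S2 - d * S1 by lra.
rewrite /S1 /S2 !mulr_sumr -sumrB; apply: eq_bigr => x _.
rewrite !mulr_sumr -sumrB; apply: eq_bigr => y _.
rewrite !mulr_sumr -sumrB; apply: eq_bigr => z _.
by case: (f x y); case: (g y z); case: (E x y z) => /=; ring.
Qed.

(** A linear functional of a weight with values in [[0, C]] is least when the weight is [C] exactly
    where its coefficient is negative. *)
Let weight_bound (f : T -> T -> R) (C : R) (c : T -> T -> R) :
  (forall x y, 0 <= f x y <= C) ->
  C * (\sum_x \sum_y (c x y < 0)%R%:R * c x y) <= \sum_x \sum_y f x y * c x y.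
Proof.
move=> hf; rewrite mulr_sumr; apply: ler_sum => x _.
rewrite mulr_sumr; apply: ler_sum => y _.
have /andP[f0 fC] := hf x y.
by case: ltP => hc /=; nra.
Qed.

(* The density deficit is linear in each of the two weights, so it is
   minimised at indicator functions. *)
Lemma cherry_dense_weighted (f g : T -> T -> R) (C D : R) :
  0 <= C -> 0 <= D ->
  (forall x y, 0 <= f x y <= C) -> (forall x y, 0 <= g x y <= D) ->
  d * (\sum_x \sum_y \sum_z f x y * g y z) - C * D * (rho * N ^+ 3)
    <= \sum_x \sum_y \sum_z f x y * g y z * Er x y z.
Proof.
move=> C0 D0 hf hg.
have phi1 g' : phi f g' = \sum_x \sum_y f x y * \sum_z g' y z * (Er x y z - d).
  apply: eq_bigr => x _; apply: eq_bigr => y _; rewrite mulr_sumr.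
  by apply: eq_bigr => z _; rewrite mulrA.
have phi2 f' g' :
    phi f' g' = \sum_y \sum_z g' y z * \sum_x f' x y * (Er x y z - d).
  rewrite /phi exchange_sum3; apply: eq_bigr => y _; apply: eq_bigr => z _.
  rewrite mulr_sumr; apply: eq_bigr => x _; ring.
have [f1 h1] : exists f1 : rel T, C * phi (fun x y => (f1 x y)%:R) g <= phi f g.
  exists (fun x y => \sum_z g y z * (Er x y z - d) < 0)%R.
  rewrite [X in _ <= X]phi1.
  apply: le_trans (weight_bound (fun x y => \sum_z g y z * (Er x y z - d)) hf).
  rewrite ler_wpM2l // /phi; apply: ler_sum => x _; apply: ler_sum => y _.
  by rewrite mulr_sumr; apply: ler_sum => z _; rewrite mulrA.
pose f1r x y := (f1 x y)%:R : R.
have [g1 h2] : exists g1 : rel T, D * phi f1r (fun x y => (g1 x y)%:R) <= phi f1r g.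
  exists (fun y z => \sum_x f1r x y * (Er x y z - d) < 0)%R; rewrite !phi2.
  exact: (weight_bound (fun y z => \sum_x f1r x y * (Er x y z - d)) hg).
have := phi_rel f1 g1; rewrite -/f1r => h3.
have h4 : - (C * D * (rho * N ^+ 3)) <= phi f g.
  apply: le_trans h1; rewrite -mulrA -mulrN ler_wpM2l //.
  by apply: le_trans h2; rewrite -mulrN ler_wpM2l.
suff -> : \sum_x \sum_y \sum_z f x y * g y z * Er x y z
   = phi f g + d * \sum_x \sum_y \sum_z f x y * g y z by lra.
rewrite mulr_sumr -big_split /=; apply: eq_bigr => x _.
rewrite mulr_sumr -big_split /=; apply: eq_bigr => y _.
rewrite mulr_sumr -big_split /=; apply: eq_bigr => z _; ring.
Qed.

(** The cherry bound is used twice: once to pass from all quadruples to those where [x y z] is an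
    edge, once to add the edge [y z w], with [(y, z)] weighted by its mass of admissible [x].
    Weights up to [N] turn each error [rho N^3] into [rho N^4], and [d <= 1] keeps the first error
    from growing. *)
Lemma tight_path4_count (F M B : T -> T -> R) :
  (forall x y, 0 <= F x y <= 1) -> (forall x y, 0 <= M x y <= 1) ->
  (forall x y, 0 <= B x y <= 1) ->
  d ^+ 2 * (\sum_x \sum_y \sum_z \sum_w F x y * M y z * B z w)
    - 2 * rho * N ^+ 4
  <= \sum_x \sum_y \sum_z \sum_w
       F x y * M y z * B z w * (Er x y z * Er y z w).
Proof.
move=> hF hM hB.
have N0 : 0 <= N by [].
pose f y z := M y z * \sum_x F x y * Er x y z.
pose h y z := M y z * \sum_w B z w.
have sum_bound (u : T -> R) : (forall t, 0 <= u t <= 1) -> 0 <= \sum_t u t <= N.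
  move=> hu; rewrite sumr_ge0 /=; last by move=> t _; case/andP: (hu t).
  apply: (@le_trans _ _ (\sum_(t : T) 1)); last by rewrite sumr_const.
  by apply: ler_sum => t _; case/andP: (hu t).
have hf y z : 0 <= f y z <= N.
  have /andP[m0 m1] := hM y z.
  have /andP[s0 s1] : 0 <= \sum_x F x y * Er x y z <= N.
    apply: sum_bound => x; have := hF x y.
    by case: (E x y z); rewrite ?mulr1 ?mulr0 // lexx ler01.
  by rewrite /f mulr_ge0 //= -[N]mul1r ler_pM.
have hh y z : 0 <= h y z <= N.
  have /andP[m0 m1] := hM y z.
  have /andP[s0 s1] := sum_bound _ (hB z).
  by rewrite /h mulr_ge0 //= -[N]mul1r ler_pM.
have k1 := cherry_dense_weighted N0 ler01 hf hB.
have k2 := cherry_dense_weighted ler01 N0 hF hh.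
set X := (X in _ <= X); set Z := (X in d ^+ 2 * X).
have eX : \sum_x \sum_y \sum_z f x y * B y z * Er x y z = X.
  rewrite /X [RHS]exchange_sum3; apply: eq_bigr => y _; apply: eq_bigr => z _.
  rewrite [RHS]exchange_big; apply: eq_bigr => w _.
  rewrite /f mulr_sumr !mulr_suml; apply: eq_bigr => x _; ring.
have eY : \sum_x \sum_y \sum_z f x y * B y z
        = \sum_x \sum_y \sum_z F x y * h y z * Er x y z.
  rewrite [RHS]exchange_sum3; apply: eq_bigr => y _; apply: eq_bigr => z _.
  rewrite -mulr_sumr /f /h; set b := \sum_w B z w.
  by rewrite mulrAC mulr_sumr; apply: eq_bigr => x _; ring.
have eZ : \sum_x \sum_y \sum_z F x y * h y z = Z.
  apply: eq_bigr => x _; apply: eq_bigr => y _; apply: eq_bigr => z _.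
  by rewrite /h mulrA mulr_sumr.
rewrite eX eY in k1; rewrite eZ in k2.
set Y := \sum_x _ in k1 k2.
have e4 : N ^+ 4 = N * N ^+ 3 by rewrite exprS.
rewrite !mulr1 in k1; rewrite !mul1r in k2.
have P0 : 0 <= rho * N ^+ 4 by rewrite mulr_ge0 // exprn_ge0.
have k3 : d * (d * Z - rho * N ^+ 4) <= d * Y.
  by rewrite ler_wpM2l //; apply: le_trans k2; rewrite e4; lra.
have k4 : d * (rho * N ^+ 4) <= rho * N ^+ 4 by rewrite ler_piMl.
have k5 : d * Y - rho * N ^+ 4 <= X by apply: le_trans k1; rewrite e4; lra.
rewrite expr2; lra.
Qed.

End Density.

(** The ordered edge [(y, z)] is the middle of [D y * D z] walks. At least [q N^2 / 2] edges have
    both ends of degree at least [q N / 4], whence [q^3 / 32]. *)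
Lemma walk3_count (R : realType) (T : finType) (L : rel T) (q : R) :
  0 <= q -> symmetric L ->
  q * #|T|%:R ^+ 2 <= \sum_x \sum_y (L x y)%:R ->
  q ^+ 3 / 32 * #|T|%:R ^+ 4 <=
    \sum_x \sum_y \sum_z \sum_w (L x y)%:R * (L y z)%:R * (L z w)%:R :> R.
Proof.
move=> q0 Lsym hq; set N : R := #|T|%:R.
have N0 : 0 <= N by [].
pose D y : R := \sum_w (L y w)%:R.
have D0 y : 0 <= D y by apply: sumr_ge0.
pose t := q * N / 4.
have t0 : 0 <= t by rewrite /t; nra.
have -> : \sum_x \sum_y \sum_z \sum_w (L x y)%:R * (L y z)%:R * (L z w)%:R
    = \sum_y \sum_z (L y z)%:R * (D y * D z).
  rewrite exchange_sum3; apply: eq_bigr => y _; apply: eq_bigr => z _.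
  transitivity (\sum_x (L x y)%:R * (L y z)%:R * D z).
    by apply: eq_bigr => x _; rewrite mulr_sumr.
  rewrite -!mulr_suml mulrA [_ * D y]mulrC; congr (_ * _ * _).
  by apply: eq_bigr => x _; rewrite Lsym.
pose low y : R := (D y < t)%R%:R.
(* An edge with an end of degree below [t] is lost; there are at most [2 N t]. *)
have lowb : \sum_y low y * D y <= N * t.
  apply: (@le_trans _ _ (\sum_(y : T) t)).
    by apply: ler_sum => y _; rewrite /low; case: ltP => /= h; lra.
  by rewrite sumr_const /N mulr_natl.
have -> : q ^+ 3 / 32 * N ^+ 4 = t ^+ 2 * (q * N ^+ 2 - 2 * (N * t)).
  by rewrite /t; field.
apply: (@le_trans _ _ (t ^+ 2 * (\sum_x \sum_y (L x y)%:R - 2 * (\sum_y low y * D y)))).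
  rewrite ler_wpM2l ?exprn_ge0 //; move: hq; rewrite -/N; lra.
have -> : \sum_x \sum_y (L x y)%:R - 2 * (\sum_y low y * D y)
    = \sum_y \sum_z (L y z)%:R * (1 - low y - low z).
  have e1 : \sum_y low y * D y = \sum_y \sum_z (L y z)%:R * low y.
    by apply: eq_bigr => y _; rewrite mulrC mulr_suml.
  have e2 : \sum_y low y * D y = \sum_y \sum_z (L y z)%:R * low z.
    rewrite exchange_big e1; apply: eq_bigr => y _; apply: eq_bigr => z _.
    by rewrite Lsym.
  have -> : 2 * (\sum_y low y * D y) = \sum_y \sum_z (L y z)%:R * low y
     + \sum_y \sum_z (L y z)%:R * low z by rewrite -e1 -e2; ring.
  rewrite opprD addrA -!sumrB; apply: eq_bigr => y _.
  rewrite -!sumrB; apply: eq_bigr => z _; ring.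
(* Termwise: if an end is low, the left side is at most 0; otherwise both degrees are at least
   [t]. *)
rewrite mulr_sumr; apply: ler_sum => y _; rewrite mulr_sumr; apply: ler_sum => z _.
rewrite mulrCA ler_wpM2l //.
have := D0 y; have := D0 z; rewrite /low.
by case: ltP => hy; case: ltP => hz /=; nra.
Qed.

(** * Tight sequences and absorption *)

Section TightSequences.

Variables (T : eqType) (E : T -> T -> T -> bool).

Fixpoint tight (s : seq T) : bool :=
  if s is x :: s1 then
    (if s1 is y :: z :: _ then E x y z else true) && tight s1
  else true.

(** Repeating the pair [x y] on both sides of the cut keeps every consecutive triple within one
    side. *)
Lemma tight_cat2 s1 x y s2 :
  tight (s1 ++ x :: y :: s2) = tight (s1 ++ [:: x; y]) && tight (x :: y :: s2).
Proof.
elim: s1 => [//|u s1 IH]; rewrite [in LHS]/= [tight ((u :: s1) ++ _)]/= IH.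
by case: s1 {IH} => [|v [|w s1]] /=; rewrite ?andbA ?andbT.
Qed.

Lemma tight_nth x0 s i : tight s -> (i.+2 < size s)%N ->
  E (nth x0 s i) (nth x0 s i.+1) (nth x0 s i.+2).
Proof.
elim: s i => [//|x s IH] [|i] /=; last by move=> /andP[_ hs] hi; apply: IH.
by case: s {IH} => [|y [|z s]] //= /andP[].
Qed.

(** Only the triples through [v] are recorded; the block's own triples come from the tight path
    containing it. *)
Definition absorbs (v : T) (b : seq T) : bool :=
  if b is [:: x1; x2; x3; x4] then [&& E x1 x2 v, E x2 v x3 & E v x3 x4]
  else false.

(** Induction on [S]: an absorber of [v] is replaced by the block with [v] in its middle. Its first
    and last pairs stay, so the junctions survive. A block of five absorbs nothing, so each
    remaining vertex loses at most one absorber while [S] loses one element. *)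
Lemma absorb_seq (S : seq T) (bs : seq (seq T)) pre post :
  (forall v, v \in S -> (size S <= count (absorbs v) bs)%N) ->
  tight (pre ++ flatten bs ++ post) ->
  exists2 s', perm_eq s' (S ++ flatten bs) & tight (pre ++ s' ++ post).
Proof.
elim: S bs => [|v S IH] bs hS ht; first by exists (flatten bs).
have : has (absorbs v) bs.
  by rewrite has_count; apply: leq_trans (hS v _); rewrite ?mem_head.
move=> hv; have [q [bs1 [bs2 [ebs abs_v]]]] :
    exists q bs1 bs2, bs = bs1 ++ q :: bs2 /\ absorbs v q.
  by case/split_find: hv => q bs1 bs2 hq _; exists q, bs1, bs2; rewrite cat_rcons.
case: q => [|x1 [|x2 [|x3 [|x4 [|x5 q]]]]] // in ebs abs_v.
have /and3P[e1 e2 e3] := abs_v.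
have [|| s' ps' ts'] := IH (bs1 ++ [:: x1; x2; v; x3; x4] :: bs2).
- move=> u uS; have := hS u; rewrite inE uS orbT => /(_ isT).
  rewrite ebs !count_cat /= add0n addnCA => h; rewrite -ltnS (leq_trans h) //.
  by rewrite -add1n leq_add2r leq_b1.
(* The triples [x1 x2 x3] and [x2 x3 x4] give way to the three triples through [v]. *)
- move: ht; rewrite ebs !flatten_cat /= -!catA /= !catA.
  rewrite (tight_cat2 _ x1 x2 (x3 :: _)) (tight_cat2 _ x1 x2 (v :: _)) /=.
  move=> /andP[-> /and3P[_ _ ht]].
  by rewrite e1 e2 e3 ht.
exists s' => //; apply: perm_trans ps' _; apply/seq.permP => P.
by rewrite ebs !flatten_cat /= !count_cat /= ?count_cat /=; ring.
Qed.

End TightSequences.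

(** * Growing an absorbing path *)

Section Construction.

Variables (R : realType) (T : finType) (E : T -> T -> T -> bool).
Local Notation N := (#|T|%:R : R).
Implicit Types (U X : {set T}) (s pre new : seq T) (bs : seq (seq T)).

Hypothesis E_rev : forall x y z, E x y z = E z y x.

(** Interface of the construction: [gamma] is the relative size required of [U], [kappa] bounds the
    relative length of the absorbing path, and [c] is the share of the weight that one absorber
    takes. One step uses at most 12 new vertices, within the bound 16 below. *)
Variables (ok good : {set T} -> T -> T -> bool) (gamma kappa c : R).
Hypothesis N_gt0 : 0 < N.
Hypothesis gamma_kappa : gamma + kappa <= 1.
Hypothesis c_bound : 0 < c <= 1.

Hypothesis good_ok_diff : forall U X a b,
  (#|X| <= 16)%N -> good U a b -> ok (U :\: X) a b.
Hypothesis good_ok : forall U a b, good U a b -> ok U a b.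
Hypothesis extend_ok : forall U X a b,
  gamma * N <= #|U|%:R -> (#|X| <= 16)%N -> ok U a b ->
  exists z w, [/\ [/\ z \in U :\: X, w \in U :\: X & z != w],
                  E a b z, E b z w & good U z w].
Hypothesis connect_ok : forall U X a b c' e,
  (#|X| <= 16)%N -> ok U a b -> ok U e c' ->
  exists z w u v,
   [/\ all (mem (U :\: X)) [:: z; w; u; v], uniq [:: z; w; u; v] &
    [/\ [/\ E a b z, E b z w & E z w u], E w u v, E u v c' & E v c' e]].
Hypothesis heavy_quad : forall U U1 (w : T -> R),
  gamma * N <= #|U|%:R -> #|~: U1|%:R <= kappa * N ->
  (forall v, 0 <= w v) -> 0 < \sum_v w v ->
  exists x1 x2 x3 x4,
   [/\ [/\ all (mem U1) [:: x1; x2; x3; x4], uniq [:: x1; x2; x3; x4],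
           E x1 x2 x3 & E x2 x3 x4],
       good U x2 x1, good U x3 x4 &
       c * (\sum_v w v) <= \sum_v w v * (absorbs E v [:: x1; x2; x3; x4])%:R].
Hypothesis initial_path : exists x y z w,
  [/\ uniq [:: x; y; z; w], E x y z, E y z w, good setT y x & good setT z w].

Definition unvisited s : {set T} := [set x | x \notin s].

Lemma card_unvisited s : uniq s -> #|unvisited s| = (#|T| - size s)%N.
Proof.
move=> us; rewrite -(card_uniqP us) -(cardC (mem s)) addKn.
by apply: eq_card => x; rewrite !inE.
Qed.

Lemma unvisited_cat s s' new :
  perm_eq s' (s ++ new) -> unvisited s' = unvisited s :\: [set x in new].
Proof.
move=> /perm_mem h; apply/setP => x.
by rewrite !inE h mem_cat negb_or andbC.
Qed.

Lemma uniq_unvisited_cat s s' new : perm_eq s' (s ++ new) ->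
  uniq s -> uniq new -> all (mem (unvisited s)) new -> uniq s'.
Proof.
move=> /perm_uniq -> us un fn; rewrite cat_uniq us un andbT /=.
by apply/hasPn => x /(allP fn) /=; rewrite inE.
Qed.

Lemma good_ok_cat s s' new a b : perm_eq s' (s ++ new) ->
  (size new <= 16)%N -> good (unvisited s) a b -> ok (unvisited s') a b.
Proof.
move=> /unvisited_cat -> hn; apply: good_ok_diff.
by rewrite cardsE (leq_trans (card_size _)).
Qed.

Lemma all_unvisited_diff s (l m : seq T) :
  all (mem (unvisited s :\: [set x in m])) l ->
  all (mem (unvisited s)) l /\ ~~ has (mem m) l.
Proof.
move=> /allP h; split; last apply/hasPn => i.
  by apply/allP => i /h /=; rewrite !inE => /andP[].
by move=> /h /=; rewrite !inE => /andP[].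
Qed.

Lemma card_seq_le (l : seq T) : (size l <= 16)%N -> (#|[set x in l]| <= 16)%N.
Proof. by move=> hl; rewrite cardsE (leq_trans (card_size _)). Qed.

(* The blocks [bs] are kept apart so that an absorber is one entry of [bs], and
   inserting a vertex into it leaves the other absorbers intact. *)
Definition chain p1 p2 pre bs a b : seq T :=
  p1 :: p2 :: pre ++ flatten bs ++ [:: a; b].

(** End pairs are read outwards, hence [p2 p1] at the left. *)
Definition extendable p1 p2 pre bs a b : Prop :=
  let s := chain p1 p2 pre bs a b in
  [/\ uniq s, tight E s, ok (unvisited s) p2 p1 & ok (unvisited s) a b].

Lemma tight_catl w z p1 p2 s :
  E p2 p1 z -> E p1 z w -> tight E (p1 :: p2 :: s) ->
  tight E (w :: z :: p1 :: p2 :: s).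
Proof. by move=> e1 e2 h; rewrite /= E_rev e2 E_rev e1; exact: h. Qed.

Lemma tight_chainr p1 p2 pre bs a b s :
  tight E (chain p1 p2 pre bs a b) -> tight E (a :: b :: s) ->
  tight E (p1 :: p2 :: pre ++ flatten bs ++ a :: b :: s).
Proof.
move=> h1 h2; rewrite -[_ :: _]/((p1 :: p2 :: pre) ++ _) catA tight_cat2 h2.
by rewrite -catA h1.
Qed.

(** The old left end joins [pre]; the old right end becomes a block of two vertices, which absorbs
    nothing, so no absorber is disturbed. *)
Lemma extend_both p1 p2 pre bs a b :
  extendable p1 p2 pre bs a b ->
  gamma * N <= #|unvisited (chain p1 p2 pre bs a b)|%:R ->
  exists w z x y,
    extendable w z (p1 :: p2 :: pre) (rcons bs [:: a; b]) x y.
Proof.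
rewrite /extendable; set s := chain _ _ _ _ _ _ => -[us ts okl okr] hU.
have [|z [w [[zU wU zw] e1 e2 g1]]] := extend_ok hU (X := [set x in [::]]) _ okl.
  exact: card_seq_le.
have [|x [y [[xU yU xy] e3 e4 g2]]] := extend_ok hU (X := [set x in [:: z; w]]) _ okr.
  exact: card_seq_le.
exists w, z, x, y; set s' := chain _ _ _ _ _ _.
have ps : perm_eq s' (s ++ [:: z; w; x; y]).
  apply/seq.permP => P; rewrite /s' /s /chain -cats1 flatten_cat /=.
  by rewrite !count_cat /= ?count_cat /= ?count_cat /=; ring.
split.
- have [|z1 _] := @all_unvisited_diff s [:: z; w] [::]; first by rewrite /= zU wU.
  have [|y1 y2] := @all_unvisited_diff s [:: x; y] [:: z; w]; first by rewrite /= xU yU.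
  apply: (uniq_unvisited_cat ps us); rewrite -[[:: z; w; x; y]]/([:: z; w] ++ [:: x; y]).
    by rewrite cat_uniq y2 /= !inE zw xy.
  by rewrite all_cat z1 y1.
- apply: tight_catl => //; rewrite -cats1 flatten_cat -!catA.
  by apply: tight_chainr => //=; rewrite e3 e4.
- exact: good_ok_cat ps _ g1.
- exact: good_ok_cat ps _ g2.
Qed.

(** The new path reads [w z p1 p2 ... a b t1 t2 t3 t4 x1 x2 x3 x4 x y]. All choices refer to the
    same unvisited set, minus the vertices already picked; the connection [t1 t2 t3 t4] is chosen
    last and avoids all the others. *)
Lemma add_absorber p1 p2 pre bs a b (wt : T -> R) :
  let s := chain p1 p2 pre bs a b in
  extendable p1 p2 pre bs a b ->
  gamma * N <= #|unvisited s|%:R -> (size s).+2%:R <= kappa * N ->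
  (forall v, 0 <= wt v) -> 0 < \sum_v wt v ->
  exists w z conn quad x y,
    [/\ extendable w z (p1 :: p2 :: pre) (bs ++ [:: conn; quad]) x y,
        size conn = 6, size quad = 4 &
        c * (\sum_v wt v) <= \sum_v wt v * (absorbs E v quad)%:R].
Proof.
move=> s [us ts okl okr] hU hs wt0 W0.
have [|z [w [[zU wU zw] e1 e2 g1]]] := extend_ok hU (X := [set x in [::]]) _ okl.
  exact: card_seq_le.
(* Outside this set lie only the path and [z], [w], hence [size s + 2] in the hypothesis. *)
have hU1 : #|~: (unvisited s :\: [set z; w])|%:R <= kappa * N.
  apply: le_trans hs; rewrite ler_nat setDE setCI setCK.
  apply: leq_trans (leq_card_setU _ _) _; rewrite cards2 -addn2 leq_add //.
    have -> : ~: unvisited s = [set x in s] by apply/setP => x; rewrite !inE negbK.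
    by rewrite cardsE card_size.
  by case: (_ != _).
have [x1 [x2 [x3 [x4 [[qU uq e3 e4] g2 g3 hW]]]]] := heavy_quad hU hU1 wt0 W0.
pose new1 := [:: z; w; x1; x2; x3; x4].
have [|x [y [[xU yU xy] e5 e6 g4]]] :=
  extend_ok hU (X := [set x in new1]) _ (good_ok g3); first exact: card_seq_le.
pose new2 := new1 ++ [:: x; y].
have [|t1 [t2 [t3 [t4 [tU ut [[e7 e8 e9] e10 e11 e12]]]]]] :=
  connect_ok (X := [set x in new2]) _ okr (good_ok g2); first exact: card_seq_le.
exists w, z, [:: a; b; t1; t2; t3; t4], [:: x1; x2; x3; x4], x, y; split=> //.
rewrite /extendable; set s' := chain _ _ _ _ _ _.
pose new := new2 ++ [:: t1; t2; t3; t4].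
have ps : perm_eq s' (s ++ new).
  apply/seq.permP => P; rewrite /s' /s /chain flatten_cat /=.
  by rewrite !count_cat /= ?count_cat /= ?count_cat /=; ring.
split.
- have [|q1 q2] := @all_unvisited_diff s [:: x1; x2; x3; x4] [:: z; w].
    by move: qU; rewrite /= !inE.
  have [|y1 y2] := @all_unvisited_diff s [:: x; y] new1; first by rewrite /= xU yU.
  have [r1 r2] := all_unvisited_diff tU.
  have [|z1 _] := @all_unvisited_diff s [:: z; w] [::]; first by rewrite /= zU wU.
  apply: (uniq_unvisited_cat ps us).
    have u1 : uniq new1.
      by rewrite -[new1]/([:: z; w] ++ [:: x1; x2; x3; x4]) cat_uniq q2 uq /= inE zw.
    have u2 : uniq new2 by rewrite cat_uniq u1 y2 /= inE xy.
    by rewrite cat_uniq u2 r2 ut.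
  rewrite /new /new2 -[new1]/([:: z; w] ++ [:: x1; x2; x3; x4]) !all_cat.
  by rewrite z1 q1 y1 r1.
- apply: tight_catl => //; rewrite flatten_cat -!catA.
  apply: tight_chainr => //=.
  by rewrite e7 e8 e9 e10 e11 e12 e3 e4 e5 e6.
- exact: good_ok_cat ps _ g1.
- exact: good_ok_cat ps _ g4.
Qed.

(* Derandomised choice of absorbers: each new one halves the weight of the vertices
   it absorbs, and averaging makes it absorb a fraction [c] of the weight. *)
Definition potential bs : R := \sum_v (2^-1) ^+ count (absorbs E v) bs.

(** The initial path has 4 vertices, and each absorber costs 12: two at either end, four to connect,
    four of its own. Each multiplies the potential by at most [1 - c / 2]. *)
Lemma absorbing_chain t : (12 * t + 4)%:R <= kappa * N ->
  exists p1 p2 pre bs a b,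
    [/\ extendable p1 p2 pre bs a b,
        size (chain p1 p2 pre bs a b) = (12 * t + 4)%N &
        potential bs <= N * (1 - c / 2) ^+ t].
Proof.
elim: t => [|t IH] ht.
  have [x [y [z [w [u1 e1 e2 g1 g2]]]]] := initial_path.
  exists x, y, [::], [::], z, w; split=> //.
    have ps : perm_eq (chain x y [::] [::] z w) ([::] ++ [:: x; y; z; w]) by [].
    have f0 : unvisited [::] = setT by apply/setP => v; rewrite !inE.
    split=> //; first by rewrite /= e1 e2.
      by apply: good_ok_cat ps _ _; rewrite ?f0.
    by apply: good_ok_cat ps _ _; rewrite ?f0.
  by rewrite /potential /= expr0 mulr1 sumr_const.
have [|p1 [p2 [pre [bs [a [b [ext sz pot]]]]]]] := IH.
  by apply: le_trans ht; rewrite ler_nat; lia.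
set s := chain _ _ _ _ _ _ in sz.
have hs2 : (size s).+2%:R <= kappa * N.
  by apply: le_trans ht; rewrite sz ler_nat; lia.
have hU : gamma * N <= #|unvisited s|%:R.
  have us : uniq s by case: ext.
  rewrite card_unvisited // natrB; last by rewrite -(card_uniqP us) max_card.
  have : (size s)%:R <= kappa * N by apply: le_trans hs2; rewrite ler_nat; lia.
  have : gamma * N + kappa * N <= N by rewrite -mulrDl ler_piMl.
  lra.
pose wt v : R := 2^-1 ^+ count (absorbs E v) bs.
have wt_gt0 v : 0 < wt v by rewrite exprn_gt0 // invr_gt0.
have W0 : 0 < \sum_v wt v.
  have /card_gt0P[v0 _] : (0 < #|T|)%N by rewrite -(ltr_nat R).
  by rewrite (bigD1 v0) //= ltr_wpDr // sumr_ge0 // => v _; exact: ltW.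
have [w [z [conn [quad [x [y [ext' sc sq hW]]]]]]] :=
  add_absorber ext hU hs2 (fun v => ltW (wt_gt0 v)) W0.
exists w, z, (p1 :: p2 :: pre), (bs ++ [:: conn; quad]), x, y; split=> //.
  move: sz; rewrite /s /chain /= ?size_cat flatten_cat /= ?size_cat sc sq /=.
  lia.
have -> : potential (bs ++ [:: conn; quad])
    = potential bs - 2^-1 * \sum_v wt v * (absorbs E v quad)%:R.
  rewrite /potential mulr_sumr -sumrB; apply: eq_bigr => v _.
  have no : absorbs E v conn = false.
    by case: conn sc {ext'} => [|? [|? [|? [|? [|? ?]]]]].
  rewrite count_cat /= no add0n addn0 exprD -/(wt v).
  by case: (absorbs _ _ _); rewrite /= ?expr0 ?expr1; lra.
apply: le_trans (_ : (1 - c / 2) * potential bs <= _).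
  rewrite /potential -/wt; move: hW; rewrite /wt; lra.
rewrite exprS mulrCA ler_wpM2l //; have /andP[_ c1] := c_bound; lra.
Qed.

(** The ends are joined through four unvisited vertices and the rest is absorbed. Appending the
    first two vertices expresses cyclic tightness as tightness of a sequence. *)
Lemma close_chain (k : nat) p1 p2 pre bs a b :
  let s := chain p1 p2 pre bs a b in
  extendable p1 p2 pre bs a b -> (#|unvisited s| <= k)%N ->
  (forall v, (k <= count (absorbs E v) bs)%N) ->
  exists cyc, [/\ uniq cyc, size cyc = #|T| & tight E (cyc ++ take 2 cyc)].
Proof.
move=> s [us ts okl okr] hk hc.
have [|t1 [t2 [t3 [t4 [tU ut [[e7 e8 e9] e10 e11 e12]]]]]] :=
  connect_ok (X := set0) _ okr okl; first by rewrite cards0.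
rewrite setD0 in tU.
pose s2 := s ++ [:: t1; t2; t3; t4].
have us2 : uniq s2 by apply: uniq_unvisited_cat us ut tU.
pose post := [:: a; b; t1; t2; t3; t4].
(* The trailing [p1 p2] carries the closing triples through the absorption. *)
have [||s' ps ts'] := @absorb_seq _ E (enum (unvisited s2)) bs
    (p1 :: p2 :: pre) (post ++ [:: p1; p2]).
- move=> v _; apply: leq_trans (hc v); apply: leq_trans hk.
  rewrite -cardE; apply: subset_leq_card; apply/subsetP => x.
  by rewrite inE [x \in unvisited s]inE mem_cat negb_or => /andP[].
- rewrite catA tight_cat2 -catA /= e7 e8 e9 e10 e11 e12 !andbT.
  exact: ts.
pose cyc := p1 :: p2 :: pre ++ s' ++ post.
have pc : perm_eq cyc (enum (unvisited s2) ++ s2).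
  have /seq.permP cs := ps.
  apply/seq.permP => P; rewrite /cyc /s2 /s /chain /= ?count_cat /= ?count_cat /= cs.
  by rewrite !count_cat /=; ring.
have uc : uniq cyc.
  rewrite (perm_uniq pc) cat_uniq enum_uniq us2 andbT andTb.
  by apply/hasPn => x xs; rewrite mem_enum inE negbK.
exists cyc; split=> //.
  rewrite -(card_uniqP uc); apply: eq_card => x.
  by rewrite (perm_mem pc) mem_cat mem_enum !inE orNb.
by move: ts'; rewrite /cyc /= take0 -!catA.
Qed.

(** An extension uses four vertices and is made only while more than [k] are unvisited, so
    [gamma N + 4 <= k] leaves at least [gamma N] of them. The induction is on a bound [m] for the
    number of unvisited vertices. *)
Lemma extend_and_close (k : nat) p1 p2 pre bs a b :
  let s := chain p1 p2 pre bs a b in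
  extendable p1 p2 pre bs a b -> gamma * N + 4 <= k%:R ->
  gamma * N <= #|unvisited s|%:R ->
  (forall v, (k <= count (absorbs E v) bs)%N) ->
  exists cyc, [/\ uniq cyc, size cyc = #|T| & tight E (cyc ++ take 2 cyc)].
Proof.
move=> s ext hk hU hc.
have [m hm] : exists m, (#|unvisited s| <= m)%N by exists #|unvisited s|.
elim: m p1 p2 pre bs a b @s ext hU hc hm => [|m IH] p1 p2 pre bs a b s ext hU hc hm.
  by apply: (close_chain ext) hc; apply: leq_trans hm _.
have [le_k|lt_k] := leqP #|unvisited s| k; first exact: close_chain ext le_k hc.
have [w [z [x [y ext']]]] := extend_both ext hU.
have us : uniq s by case: ext.
have us' : uniq (chain w z (p1 :: p2 :: pre) (rcons bs [:: a; b]) x y) by case: ext'.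
have sz : size (chain w z (p1 :: p2 :: pre) (rcons bs [:: a; b]) x y)
    = (size s + 4)%N.
  by rewrite /s /chain -cats1 flatten_cat /= ?size_cat /= ?size_cat /=; lia.
have cf := card_unvisited us; have cf' := card_unvisited us'; rewrite sz in cf'.
apply: (IH _ _ _ _ _ _ ext').
- by rewrite -(lerD2r 4) (le_trans hk) // -(natrD R _ 4) ler_nat cf'; lia.
- by move=> v; rewrite -cats1 count_cat (leq_trans (hc v)) // leq_addr.
- by rewrite cf'; lia.
Qed.

End Construction.

Lemma square_le_exp2 k : (6 <= k -> k.+1 ^ 2 <= 2 ^ k)%N.
Proof.
elim: k => // k IH; rewrite leq_eqVlt => /orP[/eqP <- //|]; rewrite ltnS => h6.
have := IH h6; rewrite [(2 ^ k.+1)%N]expnS => h.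
apply: leq_trans (_ : 2 * k.+1 ^ 2 <= _)%N; last by rewrite leq_mul2l.
rewrite -!mulnn; nia.
Qed.

(** The summand of [v] alone is at most the potential. *)
Lemma potential_count (R : realType) (T : finType) (E : T -> T -> T -> bool)
    (bs : seq (seq T)) (k : nat) :
  potential R E bs <= 2^-1 ^+ k -> forall v, (k <= count (absorbs E v) bs)%N.
Proof.
move=> h v; have half : 0 < 2^-1 :> R by rewrite invr_gt0.
rewrite -(@ler_iXn2l R 2^-1) //; last by rewrite invf_lt1 // ltr1n.
apply: le_trans h; rewrite /potential (bigD1 v) //= lerDl.
by rewrite sumr_ge0 // => u _; rewrite exprn_ge0 // ltW.
Qed.

(** * Good pairs *)

Section Walks.

Variables (R : realType) (T : finType) (E : T -> T -> T -> bool) (d rho : R).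
Hypotheses (d_gt0 : 0 < d) (d_le1 : d <= 1) (rho_ge0 : 0 <= rho).
Local Notation N := (#|T|%:R : R).
Local Notation Er x y z := ((E x y z)%:R : R).
Hypothesis E12 : forall x y z, E x y z = E y x z.
Hypothesis E23 : forall x y z, E x y z = E x z y.
Hypothesis E_uniq : forall x y z, E x y z -> uniq [:: x; y; z].
Hypothesis E_dense : forall f g : rel T,
  d * (\sum_x \sum_y \sum_z (f x y && g y z)%:R) - rho * N ^+ 3
    <= \sum_x \sum_y \sum_z ([&& f x y, g y z & E x y z])%:R.

(** [beta] is the density of extensions of an [ok] pair, [delta] bounds the density of bad pairs,
    and [q] is the link density left after discarding bad pairs and visited vertices. The hypotheses
    on [N] swallow lower-order terms. *)
Variables beta gamma delta kappa q c : R.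
Hypotheses (beta_gt0 : 0 < beta) (gamma_gt0 : 0 < gamma) (q_gt0 : 0 < q).
Hypothesis gamma_le1 : gamma <= 1.
Hypothesis beta_gamma : 4 * beta <= d ^+ 2 * gamma ^+ 2.
Hypothesis rho_delta : 4 * rho <= delta * (d ^+ 2 * gamma ^+ 2).
Hypothesis delta_beta : delta < beta / 2.
Hypothesis N_beta : 64 <= beta * N.
Hypothesis N_connect : 1 < (d ^+ 2 * (beta / 2) ^+ 2 - 2 * rho) * N.
Hypothesis link_dense : forall v,
  (2 * kappa + 2 * delta + q) * N ^+ 2 <= \sum_x \sum_y Er v x y.
Hypothesis c_gt0 : 0 < c.
Hypothesis N_quad : 1 <= (d ^+ 2 * (q ^+ 3 / 32) - 2 * rho - 2 * c) * N.

Implicit Types U X : {set T}.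

Let N_gt0 : 0 < N.
Proof.
have N0 : 0 <= N by [].
by rewrite lt_neqAle N0 andbT; apply/eqP => h; have := N_beta; rewrite -h; lra.
Qed.

Let E_rev x y z : E x y z = E z y x.
Proof. by rewrite E12 E23 E12. Qed.

Definition walks (U : {set T}) (a b : T) : {set T * T} :=
  [set p | [&& p.1 \in U, p.2 \in U, E a b p.1 & E b p.1 p.2]].

(* [good] asks for twice as much as [ok], so that a [good] pair is still [ok] after
   up to 16 vertices have been deleted from [U]. *)
Definition ok U a b := beta * N ^+ 2 <= #|walks U a b|%:R.
Definition good U a b := 2 * beta * N ^+ 2 <= #|walks U a b|%:R.

Let bool01 (b : bool) : 0 <= (b%:R : R) <= 1.
Proof. by case: b; rewrite ?lexx ?ler01. Qed.

Lemma card_set_sum (A : {set T * T}) :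
  #|A|%:R = \sum_x \sum_y ((x, y) \in A)%:R :> R.
Proof.
rewrite -(card_rel_sum R (fun x y => (x, y) \in A)); congr (_ %:R).
by apply: eq_card => -[x y]; rewrite inE.
Qed.

Lemma path4_pairs (F B : {set T * T}) :
  d ^+ 2 * (#|F|%:R * #|B|%:R) - 2 * rho * N ^+ 4 <=
  \sum_x \sum_y ((x, y) \in F)%:R *
     \sum_z \sum_w (((z, w) \in B)%:R * (Er x y z * Er y z w)).
Proof.
have := tight_path4_count (ltW d_gt0) d_le1 rho_ge0 E_dense
  (F := fun x y => ((x, y) \in F)%:R) (M := fun _ _ => 1)
  (B := fun x y => ((x, y) \in B)%:R)
  (fun _ _ => bool01 _) (fun _ _ => bool01 true) (fun _ _ => bool01 _).
set S1 := \sum_x _; set S2 := \sum_x _; set S3 := \sum_x _.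
have -> : S1 = #|F|%:R * #|B|%:R.
  rewrite !card_set_sum mulr_suml; apply: eq_bigr => x _.
  rewrite mulr_suml; apply: eq_bigr => y _; rewrite mulr_sumr.
  apply: eq_bigr => z _; rewrite mulr_sumr.
  by apply: eq_bigr => w _; rewrite mulr1.
suff -> : S2 = S3 by [].
apply: eq_bigr => x _; apply: eq_bigr => y _.
rewrite mulr_sumr; apply: eq_bigr => z _; rewrite mulr_sumr.
by apply: eq_bigr => w _; rewrite mulr1 -!mulrA.
Qed.

(** Otherwise every tight path counted has [x = w], so there are at most [N^3] of them, against
    [N_connect]. *)
Lemma connect_pairs (F B : {set T * T}) :
  beta / 2 * N ^+ 2 <= #|F|%:R -> beta / 2 * N ^+ 2 <= #|B|%:R ->
  exists x y z w, [/\ (x, y) \in F, (z, w) \in B, E x y z, E y z w & x != w].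
Proof.
move=> hF hB.
have [|noq] := boolP [exists x, [exists y, [exists z, [exists w,
  [&& (x, y) \in F, (z, w) \in B, E x y z, E y z w & x != w]]]]].
  move=> /existsP[x] /existsP[y] /existsP[z] /existsP[w] /and5P[? ? ? ? ?].
  by exists x, y, z, w.
have := path4_pairs F B; set S := \sum_x _ => hS.
have : S <= N ^+ 3.
  apply: (@le_trans _ _ (\sum_(x : T) \sum_(y : T) \sum_(z : T) 1)); last first.
    by rewrite !sumr_const -!mulrnA -natrX !expnS expn0 muln1 mulnA.
  apply: ler_sum => x _; apply: ler_sum => y _; rewrite mulr_sumr.
  apply: ler_sum => z _; rewrite mulr_sumr.
  apply: (@le_trans _ _ (\sum_w (w == x)%:R)); last first.
    by rewrite (bigD1 x) //= eqxx big1 ?addr0 // => w /negbTE ->.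
  apply: ler_sum => w _.
  move: noq => /existsPn/(_ x)/existsPn/(_ y)/existsPn/(_ z)/existsPn/(_ w).
  case: (_ \in F); case: (_ \in B); case: (E x y z); case: (E y z w) => /=;
    rewrite ?mul0r ?mulr0 ?mul1r ?ler0n //= negbK eq_sym => ->.
  exact: lexx.
have N2 : 0 <= N ^+ 2 by rewrite exprn_ge0.
have hFB : (beta / 2 * N ^+ 2) * (beta / 2 * N ^+ 2) <= #|F|%:R * #|B|%:R.
  by rewrite ler_pM // mulr_ge0 // ltW // divr_gt0.
have d2 : 0 <= d ^+ 2 by rewrite exprn_ge0 // ltW.
have h1 := ler_wpM2l d2 hFB.
have N3 : 0 < N ^+ 3 by rewrite exprn_gt0.
have h2 : 0 < N ^+ 3 * ((d ^+ 2 * (beta / 2) ^+ 2 - 2 * rho) * N - 1).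
  by rewrite mulr_gt0 // subr_gt0.
lra.
Qed.

Definition bad U : {set T * T} := [set p | ~~ good U p.1 p.2].

(** Tight paths starting with a bad pair and ending in [U] are counted twice: each bad pair has at
    most [2 beta N^2] of them, while density forces about [d^2 gamma^2 N^2] on average. Half of the
    latter remains after the comparison. *)
Lemma card_bad U : gamma * N <= #|U|%:R -> #|bad U|%:R <= delta * N ^+ 2.
Proof.
move=> hU; have := path4_pairs (bad U) (setX U U); rewrite cardsX natrM.
set S := \sum_x _ => hS.
have hS2 : S <= #|bad U|%:R * (2 * beta * N ^+ 2).
  rewrite card_set_sum mulr_suml; apply: ler_sum => x _.
  rewrite mulr_suml; apply: ler_sum => y _; rewrite inE /=.
  case: (boolP (good _ _ _)) => /=; first by rewrite !mul0r.
  rewrite /good -ltNge !mul1r => /ltW; apply: le_trans.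
  rewrite card_set_sum le_eqVlt; apply/orP; left; apply/eqP.
  apply: eq_bigr => z _; apply: eq_bigr => w _; rewrite !inE /=.
  by case: (z \in U); case: (w \in U); case: (E x y z); case: (E y z w);
    rewrite /= ?mul0r ?mulr0 ?mulr1.
have hU2 : (gamma * N) * (gamma * N) <= #|U|%:R * #|U|%:R.
  by rewrite ler_pM // mulr_ge0 // ltW.
have d2 : 0 < d ^+ 2 by rewrite exprn_gt0.
have g2 : 0 < gamma ^+ 2 by rewrite exprn_gt0.
have N2 : 0 < N ^+ 2 by rewrite exprn_gt0.
set b := #|bad U|%:R in hS hS2 *.
have b0 : 0 <= b by rewrite /b.
have h1 : d ^+ 2 * (b * ((gamma * N) * (gamma * N)))
    <= d ^+ 2 * (b * (#|U|%:R * #|U|%:R)) by rewrite ler_wpM2l ?ler_wpM2l // ltW.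
have h2 : b * N ^+ 2 * (4 * beta) <= b * N ^+ 2 * (d ^+ 2 * gamma ^+ 2).
  by rewrite ler_wpM2l // mulr_ge0 // ltW.
have h3 : N ^+ 4 * (4 * rho) <= N ^+ 4 * (delta * (d ^+ 2 * gamma ^+ 2)).
  by rewrite ler_wpM2l // exprn_ge0.
have dg : 0 < d ^+ 2 * gamma ^+ 2 by rewrite mulr_gt0.
have : (d ^+ 2 * gamma ^+ 2 * N ^+ 2) * b <=
       (d ^+ 2 * gamma ^+ 2 * N ^+ 2) * (delta * N ^+ 2) by lra.
by rewrite ler_pM2l // mulr_gt0.
Qed.

Lemma card_walks_diff U X a b :
  #|walks U a b|%:R <= #|walks (U :\: X) a b|%:R + 2 * #|X|%:R * N.
Proof.
have sub : walks U a b \subset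
    walks (U :\: X) a b :|: (setX X setT :|: setX setT X).
  apply/subsetP => -[z w]; rewrite !inE /= => /and4P[-> -> -> ->].
  by rewrite !andbT; case: (z \in X); case: (w \in X).
have := subset_leq_card sub.
have := leq_card_setU (walks (U :\: X) a b) (setX X setT :|: setX setT X).
have := leq_card_setU (setX X [set: T]) (setX [set: T] X).
rewrite !cardsX cardsT => h1 h2 h3.
rewrite -!natrM -natrD ler_nat (leq_trans h3) // (leq_trans h2) // leq_add2l.
by rewrite (leq_trans h1) // [(#|T| * _)%N]mulnC addnn -mul2n mulnA.
Qed.

(** Sixteen vertices meet at most [32 N] pairs, and [64 <= beta N]. *)
Lemma small_loss (X : {set T}) :
  (#|X| <= 16)%N -> 2 * #|X|%:R * N <= beta / 2 * N ^+ 2.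
Proof.
move=> hX; have hX' : #|X|%:R <= 16 :> R by rewrite (ler_nat R _ 16).
have h1 : #|X|%:R * N <= 16 * N by rewrite ler_wpM2r.
have h2 : 64 * N <= beta * N * N by rewrite ler_wpM2r.
rewrite expr2; lra.
Qed.

Lemma good_ok_diff U X a b : (#|X| <= 16)%N -> good U a b -> ok (U :\: X) a b.
Proof.
move=> /small_loss hX; rewrite /good /ok.
have := card_walks_diff U X a b.
have : 0 < beta * N ^+ 2 by rewrite mulr_gt0 ?exprn_gt0.
lra.
Qed.

Lemma good_ok U a b : good U a b -> ok U a b.
Proof.
by move=> h; rewrite -[U]setD0; apply: good_ok_diff => //; rewrite cards0.
Qed.

Lemma ok_diff U X a b : (#|X| <= 16)%N -> ok U a b ->
  beta / 2 * N ^+ 2 <= #|walks (U :\: X) a b|%:R.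
Proof.
move=> /small_loss hX; rewrite /ok; have := card_walks_diff U X a b; lra.
Qed.

(** At least [beta / 2 N^2] extensions survive, more than the [delta N^2] bad pairs. *)
Lemma extend_ok U X a b : gamma * N <= #|U|%:R -> (#|X| <= 16)%N -> ok U a b ->
  exists z w, [/\ [/\ z \in U :\: X, w \in U :\: X & z != w],
                  E a b z, E b z w & good U z w].
Proof.
move=> hU hX hab.
have h1 := ok_diff hX hab; have h2 := card_bad hU.
have N2 : 0 < N ^+ 2 by rewrite exprn_gt0.
have h3 : #|bad U|%:R < #|walks (U :\: X) a b|%:R :> R.
  by apply: le_lt_trans h2 (lt_le_trans _ h1); rewrite ltr_pM2r.
have /subsetPn[[z w]] : ~~ (walks (U :\: X) a b \subset bad U).
  by apply/negP => /subset_leq_card; rewrite leqNgt -(ltr_nat R) h3.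
rewrite [in X in X -> _]inE /= => /and4P[zU wU Ez Ew].
rewrite inE negbK /= => g; exists z, w; split => //; split => //.
by case/E_uniq/and3P: Ew => _; rewrite inE.
Qed.

(** Walks from [a b] are linked to reversed walks from [e c'], giving [a b z w u v c' e]. All
    inequalities except [z != v] come from the edges [z w u] and [w u v]. *)
Lemma connect_ok U X a b c' e : (#|X| <= 16)%N -> ok U a b -> ok U e c' ->
  exists z w u v,
   [/\ all (mem (U :\: X)) [:: z; w; u; v], uniq [:: z; w; u; v] &
    [/\ [/\ E a b z, E b z w & E z w u], E w u v, E u v c' & E v c' e]].
Proof.
move=> hX hab hec.
pose B := [set p | (p.2, p.1) \in walks (U :\: X) e c'].
have cB : #|B| = #|walks (U :\: X) e c'|.
  have swapK : involutive (fun p : T * T => (p.2, p.1)) by case.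
  by rewrite -(card_preimset _ (inv_inj swapK)); apply: eq_card => p; rewrite !inE.
have [||z [w [u [v [hF hB E1 E2 zv]]]]] :=
  @connect_pairs (walks (U :\: X) a b) B; try by rewrite ?cB ok_diff.
move: hF hB; rewrite [(_, _) \in walks _ _ _]inE => /and4P[/= zU wU E3 E4].
rewrite inE [(_, _) \in walks _ _ _]inE => /and4P[/= vU uU E5 E6].
exists z, w, u, v; split=> [||].
- by rewrite /= zU wU uU vU.
- have /and3P := E_uniq E1; have /and3P := E_uniq E2.
  rewrite /= !inE !negb_or => -[/andP[wu wv] uv _] [/andP[zw zu] _ _].
  by rewrite zw zu zv wu wv uv.
- by split; rewrite // E_rev.
Qed.

(** Goodness in both directions makes the relation symmetric and lets a quadruple be left through
    either end. *)
Definition good_link U U1 v x y :=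
  [&& E v x y, x \in U1, y \in U1, good U x y & good U y x].

(** The three link edges are the triples through [v]; the condition [x1 != x4] is the only
    inequality not given by the two edges. *)
Definition good_quad U U1 v x1 x2 x3 x4 :=
  [&& good_link U U1 v x1 x2, good_link U U1 v x2 x3, good_link U U1 v x3 x4,
      E x1 x2 x3, E x2 x3 x4 & x1 != x4].

(** The link loses at most [2 delta N^2] pairs bad in some direction and [2 kappa N^2] pairs with an
    end outside [U1]. *)
Lemma good_link_dense U U1 v :
  gamma * N <= #|U|%:R -> #|~: U1|%:R <= kappa * N ->
  q * N ^+ 2 <= \sum_x \sum_y (good_link U U1 v x y)%:R.
Proof.
move=> /card_bad hb hU1.
have hv := link_dense v.
suff : \sum_x \sum_y Er v x y <= \sum_x \sum_y (good_link U U1 v x y)%:R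
     + (2 * (#|bad U|%:R) + 2 * (#|~: U1|%:R * N)).
  have : #|~: U1|%:R * N <= kappa * N * N by rewrite ler_wpM2r.
  rewrite expr2 in hv hb *; lra.
have -> : 2 * (#|bad U|%:R) + 2 * (#|~: U1|%:R * N) =
  \sum_x \sum_y (((x, y) \in bad U)%:R + ((y, x) \in bad U)%:R
     + ((x \in ~: U1)%:R + (y \in ~: U1)%:R)) :> R.
  have e1 : \sum_x \sum_(y : T) (x \in ~: U1)%:R = #|~: U1|%:R * N :> R.
    rewrite -[#|~: U1|]sum1_card natr_sum mulr_suml [RHS]big_mkcond.
    apply: eq_bigr => x _ /=.
    by rewrite sumr_const; case: (x \in _); rewrite ?mul1r ?mul0rn.
  have e2 : \sum_(x : T) \sum_y (y \in ~: U1)%:R = #|~: U1|%:R * N :> R.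
    by rewrite exchange_big.
  have e3 : \sum_x \sum_y ((y, x) \in bad U)%:R = #|bad U|%:R :> R.
    by rewrite exchange_big card_set_sum.
  transitivity (\sum_x \sum_y ((x, y) \in bad U)%:R
      + \sum_x \sum_y ((y, x) \in bad U)%:R
      + (\sum_x \sum_(y : T) (x \in ~: U1)%:R + \sum_(x : T) \sum_y (y \in ~: U1)%:R) : R).
    rewrite -card_set_sum e1 e2 e3; ring.
  rewrite -!big_split /=; apply: eq_bigr => x _.
  by rewrite -!big_split /=; apply: eq_bigr => y _.
rewrite -big_split /=; apply: ler_sum => x _.
rewrite -big_split /=; apply: ler_sum => y _.
rewrite /good_link !inE /=.
by case: (E v x y); case: (x \in U1); case: (y \in U1); case: (good U x y);
  case: (good U y x) => /=; lra.
Qed.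

(** The link has [q^3 / 32 N^4] walks, density makes a share [d^2] of them tight up to [2 rho N^4],
    and at most [N^3] have [x1 = x4]. *)
Lemma good_quad_count U U1 v :
  gamma * N <= #|U|%:R -> #|~: U1|%:R <= kappa * N ->
  2 * c * N ^+ 4 <= \sum_x1 \sum_x2 \sum_x3 \sum_x4
    (good_quad U U1 v x1 x2 x3 x4)%:R.
Proof.
move=> hU hU1; have hL := good_link_dense v hU hU1.
pose L := good_link U U1 v.
have Lsym : symmetric L.
  move=> x y; rewrite /L /good_link E23.
  by case: (x \in U1); case: (y \in U1); case: (good U x y); case: (good U y x);
    rewrite ?andbF.
have h1 := walk3_count (ltW q_gt0) Lsym hL.
have h2 := tight_path4_count (ltW d_gt0) d_le1 rho_ge0 E_dense
  (F := fun x y => (L x y)%:R) (M := fun x y => (L x y)%:R)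
  (B := fun x y => (L x y)%:R)
  (fun _ _ => bool01 _) (fun _ _ => bool01 _) (fun _ _ => bool01 _).
set S1 := \sum_x _ in h1 h2; set S2 := \sum_x _ in h2.
set S3 := \sum_x1 _.
have h3 : S2 <= S3 + N ^+ 3.
  have -> : N ^+ 3 = \sum_(x : T) \sum_(y : T) \sum_(z : T) \sum_(w : T) (w == x)%:R.
    transitivity (\sum_(x : T) \sum_(y : T) \sum_(z : T) 1 : R).
      by rewrite !sumr_const -!mulrnA -natrX !expnS expn0 muln1 mulnA.
    apply: eq_bigr => x _; apply: eq_bigr => y _; apply: eq_bigr => z _.
    by rewrite (bigD1 x) //= eqxx big1 ?addr0 // => w /negbTE ->.
  rewrite -big_split /=; apply: ler_sum => x _.
  rewrite -big_split /=; apply: ler_sum => y _.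
  rewrite -big_split /=; apply: ler_sum => z _.
  rewrite -big_split /=; apply: ler_sum => w _.
  rewrite /good_quad -/L [w == x]eq_sym.
  by case: (L x y); case: (L y z); case: (L z w); case: (E x y z);
    case: (E y z w); case: (x == w) => /=; lra.
have d2 : 0 <= d ^+ 2 by rewrite exprn_ge0 // ltW.
have h4 := ler_wpM2l d2 h1.
have N3 : 0 <= N ^+ 3 by rewrite exprn_ge0.
have h5 := ler_wpM2l N3 N_quad.
lra.
Qed.

Lemma exchange_weighted4 (w : T -> R) (F : T -> T -> T -> T -> T -> R) :
  \sum_v w v * (\sum_x \sum_y \sum_z \sum_t F v x y z t) =
  \sum_x \sum_y \sum_z \sum_t \sum_v w v * F v x y z t.
Proof.
under eq_bigr => v _ do rewrite mulr_sumr.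
rewrite exchange_big; apply: eq_bigr => x _.
under eq_bigr => v _ do rewrite mulr_sumr.
rewrite exchange_big; apply: eq_bigr => y _.
under eq_bigr => v _ do rewrite mulr_sumr.
rewrite exchange_big; apply: eq_bigr => z _.
under eq_bigr => v _ do rewrite mulr_sumr.
by rewrite exchange_big.
Qed.

(** Averaging: the weights [A] sum to at least [2 c N^4 W], so one of the [N^4] quadruples exceeds
    [c W]. *)
Lemma heavy_quad U U1 (w : T -> R) :
  gamma * N <= #|U|%:R -> #|~: U1|%:R <= kappa * N ->
  (forall v, 0 <= w v) -> 0 < \sum_v w v ->
  exists x1 x2 x3 x4,
   [/\ [/\ all (mem U1) [:: x1; x2; x3; x4], uniq [:: x1; x2; x3; x4],
           E x1 x2 x3 & E x2 x3 x4],
       good U x2 x1, good U x3 x4 &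
       c * (\sum_v w v) <= \sum_v w v * (absorbs E v [:: x1; x2; x3; x4])%:R].
Proof.
move=> hU hU1 w0 W0; set W := \sum_v w v in W0 *.
pose A x1 x2 x3 x4 := \sum_v w v * (good_quad U U1 v x1 x2 x3 x4)%:R.
have hA : 2 * c * N ^+ 4 * W <= \sum_x1 \sum_x2 \sum_x3 \sum_x4 A x1 x2 x3 x4.
  rewrite -exchange_weighted4 /W mulr_sumr; apply: ler_sum => v _.
  by rewrite mulrC ler_wpM2l // good_quad_count.
have [|noq] := boolP [exists x1, [exists x2, [exists x3, [exists x4,
    c * W < A x1 x2 x3 x4]]]].
  move=> /existsP[x1] /existsP[x2] /existsP[x3] /existsP[x4] hx.
  (* Positive weight gives some [v] for which the quadruple is good; its tightness and the goodness
     of its ends do not depend on [v]. *)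
  have [v hv] : exists v, good_quad U U1 v x1 x2 x3 x4.
    apply/existsP; apply: contraT => /existsPn no.
    suff A0 : A x1 x2 x3 x4 = 0.
      by move: hx; rewrite A0 ltNge mulr_ge0 // ltW.
    by apply: big1 => v _; rewrite (negbTE (no v)) mulr0.
  have /and5P[/and5P[_ i1 i2 _ g21] _ /and5P[_ i3 i4 g34 _] E1 /andP[E2 n14]] := hv.
  exists x1, x2, x3, x4; split=> //.
    split=> //; first by rewrite /= i1 i2 i3 i4.
    have /and3P := E_uniq E1; have /and3P := E_uniq E2.
    rewrite /= !inE !negb_or => -[/andP[n23 n24] n34 _] [/andP[n12 n13] _ _].
    by rewrite n12 n13 n14 n23 n24 n34.
  apply: le_trans (ltW hx) _; apply: ler_sum => u _; rewrite ler_wpM2l // ler_nat.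
  rewrite /absorbs /good_quad; case: (boolP (good_link _ _ _ x1 x2)) => //=.
  case/andP=> e1 _; case: (boolP (good_link _ _ _ x2 x3)) => //= /andP[e2 _].
  case: (boolP (good_link _ _ _ x3 x4)) => //= /andP[e3 _].
  by rewrite [E x1 x2 u]E23 [E x1 u x2]E12 e1 [E x2 u x3]E12 e2 e3 leq_b1.
have : \sum_x1 \sum_x2 \sum_x3 \sum_x4 A x1 x2 x3 x4 <= c * W * N ^+ 4.
  apply: (@le_trans _ _ (\sum_(x1 : T) \sum_(x2 : T) \sum_(x3 : T) \sum_(x4 : T) c * W)).
    apply: ler_sum => x1 _; apply: ler_sum => x2 _; apply: ler_sum => x3 _.
    apply: ler_sum => x4 _; rewrite leNgt.
    by move: noq => /existsPn/(_ x1)/existsPn/(_ x2)/existsPn/(_ x3)/existsPn/(_ x4).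
  by rewrite !sumr_const -!mulrnA -natrX mulr_natr !expnS expn0 muln1 !mulnA.
have : 0 < c * W * N ^+ 4 by rewrite !mulr_gt0 // exprn_gt0.
lra.
Qed.

(** Most pairs are good for the whole vertex set, so a reversed good pair can be linked to a good
    pair. *)
Lemma initial_path : exists x y z w,
  [/\ uniq [:: x; y; z; w], E x y z, E y z w, good setT y x & good setT z w].
Proof.
have hU : gamma * N <= #|[set: T]|%:R by rewrite cardsT ler_piMl.
have hb := card_bad hU.
have swapK : involutive (fun p : T * T => (p.2, p.1)) by case.
have hB : beta / 2 * N ^+ 2 <= #|~: bad setT|%:R.
  have e : #|bad setT|%:R + #|~: bad setT|%:R = N ^+ 2 :> R.
    by rewrite -natrD cardsC card_prod natrM expr2.
  have dg : d ^+ 2 * gamma ^+ 2 <= 1.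
    by rewrite mulr_ile1 ?exprn_ge0 ?exprn_ile1 // ltW.
  have : (beta / 2 + delta) * N ^+ 2 <= 1 * N ^+ 2.
    have b1 := le_trans beta_gamma dg.
    rewrite ler_wpM2r ?exprn_ge0 //.
    have b2 := ltW delta_beta.
    lra.
  lra.
pose F := [set p : T * T | (p.2, p.1) \in ~: bad setT].
have cF : #|F| = #|~: bad setT|.
  by rewrite -(card_preimset _ (inv_inj swapK)); apply: eq_card => p; rewrite !inE.
have [||x [y [z [w [hF hB' e1 e2 xw]]]]] := @connect_pairs F (~: bad setT);
  rewrite ?cF //.
exists x, y, z, w; split=> //; last 2 first.
- by move: hF; rewrite !inE negbK.
- by move: hB'; rewrite !inE negbK.
have /and3P := E_uniq e1; have /and3P := E_uniq e2.
rewrite /= !inE !negb_or => -[/andP[yz yw] zw _] [/andP[xy xz] _ _].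
by rewrite xy xz xw yz yw zw.
Qed.

(** With [k] about [N / K], a path with [m k] absorbers is short enough for [kappa] and gives every
    vertex [k] absorbers. *)
Lemma tight_cycle_of_parameters (m K : nat) :
  gamma + kappa <= 1 -> c <= 1 -> (0 < K)%N -> gamma * (2 * K%:R) <= 1 ->
  (1 - c / 2) ^+ m <= 4^-1 -> 24 * m%:R <= kappa * K%:R -> 0 <= kappa ->
  8 <= kappa * N -> (K * (K + 10) <= #|T|)%N ->
  exists cyc : seq T,
    [/\ uniq cyc, size cyc = #|T| & tight E (cyc ++ take 2 cyc)].
Proof.
move=> gk c_le1 K_gt0 gK hm hK k_ge0 Nk hT.
pose k := (#|T| %/ K)%N.
have kK : (k * K <= #|T|)%N by apply: leq_trunc_div.
have Kk : (#|T| < k.+1 * K)%N by rewrite ltn_ceil.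
have kbig : (K + 10 <= k)%N by rewrite leq_divRL // mulnC.
have k10 : (10 <= k)%N by rewrite (leq_trans _ kbig) // leq_addl.
move: k kK Kk kbig k10 => k kK Kk kbig k10.
(* Here [gamma N <= (k + 1) / 2], which is at most [k - 4] because [k >= 10]. *)
have Ngamma : gamma * N + 4 <= k%:R.
  have h1 : gamma * N <= gamma * (k.+1%:R * K%:R).
    by rewrite ler_wpM2l ?(ltW gamma_gt0) // -natrM ler_nat ltnW.
  have h2 : 10 <= k%:R :> R by rewrite (ler_nat R 10).
  have h3 : k.+1%:R * (gamma * (2 * K%:R)) <= k.+1%:R * 1 by rewrite ler_wpM2l.
  rewrite -natr1 in h1 h3; lra.
have ht : (12 * (m * k) + 4)%:R <= kappa * N.
  rewrite natrD !natrM.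
  have h1 : k%:R * K%:R <= N by rewrite -natrM ler_nat.
  have h2 := ler_wpM2l k_ge0 h1.
  have h3 : 24 * m%:R * k%:R <= kappa * K%:R * k%:R by rewrite ler_wpM2r.
  lra.
have c01 : 0 < c <= 1 by rewrite c_gt0.
have [p1 [p2 [pre [bs [a [b [ext sz pot]]]]]]] :=
  absorbing_chain E_rev N_gt0 gk c01 good_ok_diff good_ok extend_ok connect_ok
    heavy_quad initial_path ht.
have us : uniq (chain p1 p2 pre bs a b) by case: ext.
apply: (extend_and_close E_rev N_gt0 gk c01 good_ok_diff extend_ok connect_ok ext
  Ngamma).
  rewrite card_unvisited // natrB; last by rewrite -(card_uniqP us) max_card.
  have : gamma * N + kappa * N <= N by rewrite -mulrDl ler_piMl.
  rewrite sz; lra.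
apply: (@potential_count R); apply: le_trans pot _.
(* [N <= (k + 1) K <= (k + 1)^2 <= 2^k]. *)
have Nk2 : N <= 2 ^+ k.
  rewrite -natrX ler_nat (leq_trans (ltnW Kk)) //.
  apply: leq_trans (square_le_exp2 (leq_trans _ k10)) => //.
  by rewrite -mulnn leq_mul2l /= (leq_trans (leq_addr 10 K)) // (leq_trans kbig).
have c2 : 0 <= 1 - c / 2 by lra.
(* The potential is at most [2^k 4^-k = 2^-k]. *)
rewrite exprM; apply: (@le_trans _ _ (2 ^+ k * 4^-1 ^+ k)).
  rewrite ler_pM ?exprn_ge0 // lerXn2r ?nnegrE ?invr_ge0 ?exprn_ge0 //.
have -> : 4^-1 = 2^-1 * 2^-1 :> R by rewrite -invfM -natrM.
by rewrite exprMn mulrA -exprMn mulfV ?expr1n ?mul1r // pnatr_eq0.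
Qed.

End Walks.

(** * Choice of the constants *)

(** Bernoulli's inequality, with [m x >= 3]. *)
Lemma geometric_le_quarter (R : realType) (x : R) : 0 < x -> x < 1 ->
  exists m : nat, (1 - x) ^+ m <= 4^-1.
Proof.
move=> x0 x1; have bern m : (1 - x) ^+ m * (1 + m%:R * x) <= 1.
  elim: m => [|m IH]; first by rewrite expr0 mul0r addr0 mulr1.
  apply: le_trans IH; rewrite exprSr -mulrA ler_wpM2l //.
    by rewrite exprn_ge0 // subr_ge0 ltW.
  have : 0 <= m%:R * (x * x) by rewrite !mulr_ge0 // ltW.
  have : 0 <= x * x by rewrite mulr_ge0 // ltW.
  rewrite -natr1; lra.
exists (Num.bound (3 / x)).
have := @archi_boundP _ (3 / x); rewrite divr_ge0 ?(ltW x0) // => /(_ isT).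
rewrite ltr_pdivrMr // => hm; have := bern (Num.bound (3 / x)).
set p := (1 - x) ^+ _.
have p0 : 0 <= p by rewrite exprn_ge0 // subr_ge0 ltW.
have := ler_wpM2l p0 (ltW hm); lra.
Qed.

(** The constants are fixed in the order [q], [kappa], [c], [m], [K], [gamma], [beta], [delta],
    [rho], [n0], each depending only on [alpha], [d] and earlier ones. *)
Lemma tight_cycle_exists (R : realType) (alpha d : R) :
  0 < alpha -> alpha <= 1 -> 0 < d -> d <= 1 ->
  exists (n0 : nat) (rho : R), 0 < rho /\
  forall (T : finType) (E : T -> T -> T -> bool),
    (forall x y z, E x y z = E y x z) -> (forall x y z, E x y z = E x z y) ->
    (forall x y z, E x y z -> uniq [:: x; y; z]) ->
    (forall f g : rel T,
      d * (\sum_x \sum_y \sum_z (f x y && g y z)%:R) - rho * #|T|%:R ^+ 3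
        <= \sum_x \sum_y \sum_z ([&& f x y, g y z & E x y z])%:R) ->
    (forall v, alpha / 4 * #|T|%:R ^+ 2 <= \sum_x \sum_y (E v x y)%:R) ->
    (n0 <= #|T|)%N ->
  exists cyc : seq T,
    [/\ uniq cyc, size cyc = #|T| & tight E (cyc ++ take 2 cyc)].
Proof.
move=> a0 a1 d0 d1.
(* With [delta <= alpha / 32], the sum [2 kappa + 2 delta + q] is at most [alpha / 4]. *)
pose q := alpha / 8; pose kappa := alpha / 32.
have q0 : 0 < q by rewrite divr_gt0.
have k0 : 0 < kappa by rewrite divr_gt0.
pose c1 := d ^+ 2 * (q ^+ 3 / 32); pose c := c1 / 8.
have d2 : 0 < d ^+ 2 by rewrite exprn_gt0.
have d2le : d ^+ 2 <= 1 by rewrite exprn_ile1 // ltW.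
have c10 : 0 < c1 by rewrite mulr_gt0 // divr_gt0 // exprn_gt0.
have q1 : q <= 1 by rewrite /q; lra.
have c11 : c1 <= 1.
  rewrite mulr_ile1 ?(ltW d2) // ?divr_ge0 ?exprn_ge0 ?(ltW q0) //.
  have : q ^+ 3 <= 1 by rewrite exprn_ile1 // ltW.
  lra.
have c0 : 0 < c by rewrite divr_gt0.
have cle : c <= 1 by rewrite /c; lra.
have [m hm] : exists m : nat, (1 - c / 2) ^+ m <= 4^-1.
  by apply: geometric_le_quarter; rewrite ?divr_gt0 //; lra.
have big_enough (x y : R) n : 0 <= x -> 0 < y -> (Num.bound (x / y) <= n)%N ->
    x < y * n%:R.
  move=> x0 y0 hn; have := archi_boundP (divr_ge0 x0 (ltW y0)).
  rewrite ltr_pdivrMr // => h; apply: lt_le_trans h _.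
  by rewrite mulrC ler_wpM2l ?(ltW y0) // ler_nat.
pose K := (Num.bound (24 * m%:R / kappa)).+1.
have hK : 24 * m%:R <= kappa * K%:R.
  by apply/ltW/big_enough; rewrite ?mulr_ge0.
have K0 : 0 < K%:R :> R by rewrite ltr0n.
pose gamma : R := (2 * K%:R)^-1.
have g0 : 0 < gamma by rewrite invr_gt0 mulr_gt0.
have gle : gamma <= 2^-1.
  by rewrite lef_pV2 ?posrE ?mulr_gt0 // ler_peMr // ler1n.
pose beta := d ^+ 2 * gamma ^+ 2 / 4.
have g2 : 0 < gamma ^+ 2 by rewrite exprn_gt0.
have dg : 0 < d ^+ 2 * gamma ^+ 2 by rewrite mulr_gt0.
have b0 : 0 < beta by rewrite divr_gt0.
pose delta := Num.min (beta / 4) (alpha / 32).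
have de0 : 0 < delta by rewrite lt_min !divr_gt0.
have de1 : delta <= beta / 4 by rewrite ge_min lexx.
have de2 : delta <= alpha / 32 by rewrite ge_min lexx orbT.
pose c2 := d ^+ 2 * (beta / 2) ^+ 2.
have c20 : 0 < c2 by rewrite mulr_gt0 // exprn_gt0 // divr_gt0.
pose rho := Num.min (delta * (d ^+ 2 * gamma ^+ 2) / 4) (Num.min (c2 / 4) (c1 / 8)).
have rho0 : 0 < rho by rewrite !lt_min !divr_gt0 // mulr_gt0.
have rho1 : rho <= delta * (d ^+ 2 * gamma ^+ 2) / 4 by rewrite ge_min lexx.
have rho2 : rho <= c2 / 4 by rewrite !ge_min lexx orbT.
have rho3 : rho <= c1 / 8 by rewrite !ge_min lexx !orbT.
pose n0 := maxn (K * (K + 10)) (maxn (Num.bound (64 / beta))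
  (maxn (Num.bound (4 / c2)) (maxn (Num.bound (2 / c1)) (Num.bound (8 / kappa))))).
exists n0, rho; split=> // T E E12 E23 E_uniq E_dense link hn.
set N : R := #|T|%:R.
have := hn; rewrite !geq_max => /and5P[hn1 hn2 hn3 hn4 hn5].
have nb : 64 < beta * N by exact: big_enough.
have nc2 : 4 < c2 * N by exact: big_enough.
have nc1 : 2 < c1 * N by exact: big_enough.
have nk : 8 < kappa * N by exact: big_enough.
have N_ge0 : 0 <= N by [].
have N0 : 0 < N.
  rewrite lt_neqAle N_ge0 andbT; apply/eqP => h.
  by move: nb; rewrite -h mulr0 ltNge ler0n.
have beta_gamma : 4 * beta <= d ^+ 2 * gamma ^+ 2 by rewrite /beta; lra.
have rho_delta : 4 * rho <= delta * (d ^+ 2 * gamma ^+ 2).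
  by rewrite mulrC -ler_pdivlMr.
have delta_beta : delta < beta / 2.
  by apply: le_lt_trans de1 _; rewrite ltr_pM2l // ltf_pV2 ?posrE // ltr_nat.
have N_connect : 1 < (d ^+ 2 * (beta / 2) ^+ 2 - 2 * rho) * N.
  have h : (c2 - 2 * (c2 / 4)) * N <= (c2 - 2 * rho) * N.
    by rewrite ler_wpM2r // lerB // ler_wpM2l.
  by apply: lt_le_trans h; lra.
have link_dense v : (2 * kappa + 2 * delta + q) * N ^+ 2 <= \sum_x \sum_y (E v x y)%:R.
  apply: le_trans (link v); rewrite ler_wpM2r ?exprn_ge0 //.
  by rewrite /kappa /q; move: de2; clear; lra.
have N_quad : 1 <= (d ^+ 2 * (q ^+ 3 / 32) - 2 * rho - 2 * c) * N.
  have h : (c1 - 2 * (c1 / 8) - 2 * c) * N <= (c1 - 2 * rho - 2 * c) * N.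
    by rewrite ler_wpM2r // lerB // lerB // ler_wpM2l.
  by apply: le_trans h; rewrite /c; lra.
have gle1 : gamma <= 1 by lra.
have gk : gamma + kappa <= 1 by rewrite /kappa; lra.
apply: (tight_cycle_of_parameters d0 d1 (ltW rho0) E12 E23 E_uniq E_dense
  b0 g0 q0 gle1 beta_gamma rho_delta delta_beta (ltW nb) N_connect link_dense
  c0 N_quad gk cle _ _ hm hK (ltW k0) (ltW nk) hn1) => //.
by rewrite mulVf // gt_eqF // mulr_gt0.
Qed.

(** * Hypergraphs *)

Lemma card_rel3_sum (R : pzSemiRingType) (T : finType) (P : T -> T -> T -> bool) :
  #|[set t : T * T * T | P t.1.1 t.1.2 t.2]|%:R
    = \sum_x \sum_y \sum_z (P x y z)%:R :> R.
Proof.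
rewrite pair_big pair_big /= -sum1_card natr_sum big_mkcond /=.
by apply: eq_bigr => -[[x y] z] _; rewrite inE /=; case: (P x y z).
Qed.

Lemma min_deg_le n (H : hyp3 n) v : (min_deg H <= hdeg H v)%N.
Proof.
rewrite /min_deg; have : v \in index_enum 'I_n by rewrite mem_index_enum.
elim: (index_enum _) => // u r IH; rewrite inE big_cons => /orP[/eqP <-|/IH h].
  exact: geq_minl.
exact: leq_trans (geq_minr _ _) h.
Qed.

(** Source of the factor [1 / 4] in the link density. *)
Lemma square_le_bin2 n : (1 < n -> n ^ 2 <= 4 * 'C(n, 2))%N.
Proof.
by move=> n1; have := mul_bin_diag n 1; rewrite bin1 -mulnn; nia.
Qed.

Section Adjacency.

Variables (n : nat) (H : hyp3 n).

Definition adj (x y z : 'I_n) := [set x; y; z] \in hedges H.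

Lemma adj12 x y z : adj x y z = adj y x z.
Proof. by rewrite /adj [[set x; y]]setUC. Qed.

Lemma adj23 x y z : adj x y z = adj x z y.
Proof. by rewrite /adj setUAC. Qed.

Lemma adj_uniq x y z : adj x y z -> uniq [:: x; y; z].
Proof.
move/hedges_card3; have -> : [set x; y; z] = [set i in [:: x; y; z]].
  by apply/setP => i; rewrite !inE orbA.
by rewrite cardsE => h; apply/card_uniqP; rewrite h.
Qed.

(** Sending [(x, y)] to [{v, x, y}] maps the ordered link pairs onto the edges at [v]. *)
Lemma hdeg_le_sum (R : realType) v :
  (hdeg H v)%:R <= \sum_x \sum_y (adj v x y)%:R :> R.
Proof.
rewrite -card_rel_sum ler_nat.
apply: leq_trans (leq_imset_card (fun p => [set v; p.1; p.2]) _).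
apply: subset_leq_card; apply/subsetP => e; rewrite inE => /andP[eH ve].
have /eqP/cards2P[x [y [_ exy]]] : #|e :\ v| = 2.
  by have := cardsD1 v e; rewrite ve (hedges_card3 eH) => -[].
have e_eq : e = [set v; x; y] by rewrite -(setD1K ve) exy setUA.
by apply/imsetP; exists (x, y); rewrite // inE /adj /= -e_eq.
Qed.

Lemma adj_dense (R : realType) (rho d : R) : cherry_dense H rho d ->
  forall f g : rel 'I_n,
  d * (\sum_x \sum_y \sum_z (f x y && g y z)%:R) - rho * #|'I_n|%:R ^+ 3
    <= \sum_x \sum_y \sum_z ([&& f x y, g y z & adj x y z])%:R.
Proof.
move=> hd f g; have := hd [set p | f p.1 p.2] [set p | g p.1 p.2].
rewrite -!card_rel3_sum card_ord /e_H.
congr (_ * _%:R - _ <= _%:R); apply: eq_card => t; rewrite !inE //=.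
by rewrite andbA.
Qed.

(** Positions below [n + 2] of the prolonged sequence are read modulo [n], matching the cyclic
    successor [ordS]. *)
Lemma tight_cycle_perm (cyc : seq 'I_n) : (1 < n)%N ->
  uniq cyc -> size cyc = n -> tight adj (cyc ++ take 2 cyc) ->
  has_tight_ham_cycle H.
Proof.
move=> n1 uc sc tc; pose x0 : 'I_n := Ordinal (ltnW n1).
have nth_wrap j : (j < n.+2)%N ->
    nth x0 (cyc ++ take 2 cyc) j = nth x0 cyc (j %% n).
  move=> jn; rewrite nth_cat sc; case: ltnP => hj; first by rewrite modn_small.
  rewrite nth_take; last by rewrite ltn_subLR // addn2.
  by rewrite -[in RHS](subnK hj) modnDr modn_small // ltn_subLR; lia.
have inj : injective (fun i : 'I_n => nth x0 cyc i).
  by move=> i j /eqP; rewrite nth_uniq ?sc // => /eqP/val_inj.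
exists (perm inj) => i; rewrite !permE /=.
have tk : size (take 2 cyc) = 2 by rewrite size_takel // sc.
have := @tight_nth _ _ x0 _ i tc; rewrite size_cat tk sc addn2 !ltnS ltn_ord.
move=> /(_ isT); have i_lt := ltn_ord i; rewrite !nth_wrap ?ltnS //; last 2 first.
- exact: ltnW.
- exact: ltnW (ltnW _).
have e2 : ((i.+1 %% n).+1 %% n = i.+2 %% n)%N by rewrite -addn1 modnDml addn1.
by rewrite (modn_small i_lt) e2.
Qed.

End Adjacency.

Theorem theorem1p2 (R : realType) (alpha d : R) :
  0 < alpha -> alpha <= 1 -> 0 < d -> d <= 1 ->
  exists (n0 : nat) (rho : R), 0 < rho /\
    forall (n : nat) (H : hyp3 n), (n0 <= n)%N ->
      cherry_dense H rho d ->
      alpha * ('C(n, 2))%:R <= (min_deg H)%:R ->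
      has_tight_ham_cycle H.
Proof.
move=> a0 a1 d0 d1.
have [n0 [rho [rho0 cycP]]] := tight_cycle_exists a0 a1 d0 d1.
(* At least two vertices are needed for [n^2 <= 4 'C(n, 2)] and for [take 2] to have two entries. *)
exists (maxn 2 n0), rho; split=> // n H; rewrite geq_max => /andP[n2 n_n0] hd hdeg.
have [||cyc [uc sc tc]] := cycP _ _ (@adj12 n H) (@adj23 n H) (@adj_uniq n H)
  (adj_dense hd).
- move=> v; apply: le_trans (hdeg_le_sum H R v).
  apply: (@le_trans _ _ (min_deg H)%:R); last by rewrite ler_nat min_deg_le.
  apply: le_trans hdeg; rewrite card_ord -mulrA ler_wpM2l ?(ltW a0) //.
  rewrite mulrC ler_pdivrMr // mulrC -natrX -(natrM R 4) ler_nat.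
  exact: square_le_bin2.
- by rewrite card_ord.
apply: tight_cycle_perm n2 uc _ tc; by rewrite sc card_ord.
Qed.
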